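(* Let $n\ge 0$ and $k\ge 1$ be integers, and let $T$ be the triangle with vertices $(L_n,L_{n+k})$, $(L_{n+2k},L_{n+3k})$, $(L_{n+4k},L_{n+5k})$. Then the area of $T$ equals $\dfrac{25}{2}F_k^4L_k$ if $k$ is even, and $\dfrac{5F_k^2L_k^3}{2}$ if $k$ is odd.
   Context: $F_n$ denotes the Fibonacci numbers ($F_0=0$, $F_1=1$, $F_{n+1}=F_n+F_{n-1}$) and $L_n$ the Lucas numbers ($L_0=2$, $L_1=1$, $L_{n+1}=L_n+L_{n-1}$). The area of the triangle with vertices $(x_1,y_1),(x_2,y_2),(x_3,y_3)$ is $\frac12\left|(x_2-x_1)(y_3-y_1)-(x_3-x_1)(y_2-y_1)\right|$. *)

(* Defs.v *)
From mathcomp Require Import all_boot all_order all_algebra.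

Set Implicit Arguments.
Unset Strict Implicit.
Unset Printing Implicit Defensive.

Import GRing.Theory Num.Theory.

Fixpoint fib (n : nat) : nat :=
  match n with
  | 0 => 0
  | 1 => 1
  | (m.+1 as p).+1 => fib p + fib m
  end.

Fixpoint lucas (n : nat) : nat :=
  match n with
  | 0 => 2
  | 1 => 1
  | (m.+1 as p).+1 => lucas p + lucas m
  end.

Local Open Scope ring_scope.

Definition triangle_area (R : realFieldType) (p1 p2 p3 : R * R) : R :=
  2^-1 * `|(p2.1 - p1.1) * (p3.2 - p1.2) - (p3.1 - p1.1) * (p2.2 - p1.2)|.

Definition lucas_point (R : realFieldType) (i j : nat) : R * R :=
  ((lucas i)%:R, (lucas j)%:R).

(* Main.v *)
Require Import Defs.
From mathcomp Require Import all_boot all_order all_algebra.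
From mathcomp Require Import ring.

(** Put x_i = L_(n+ik).  With s = (-1)^k we have x_(i+2) = L_k x_(i+1) - s x_i,
    so the determinant giving twice the area is a polynomial in x_0, x_1, L_k, s;
    it factors as L_k (L_k^2 - (1 + s)^2) Q, where
    Q = x_1^2 - L_k x_0 x_1 + s x_0^2 equals
    F_k^2 (L_(n+1)^2 - L_(n+1) L_n - L_n^2) = -5 (-1)^n F_k^2.
    For k even one concludes with L_k^2 - 4 = 5 F_k^2. *)

Import GRing.Theory Num.Theory.
Local Open Scope ring_scope.

Section FibonacciLucas.
Variable R : comNzRingType.
Implicit Types m k : nat.

Lemma natr_fibSS k : (fib k.+2)%:R = (fib k.+1)%:R + (fib k)%:R :> R.
Proof. by rewrite -natrD. Qed.

Lemma natr_lucasSS k : (lucas k.+2)%:R = (lucas k.+1)%:R + (lucas k)%:R :> R.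
Proof. by rewrite -natrD. Qed.

(** The form a^2 - a b - b^2 changes sign under (a, b) -> (a + b, a), one step of the recurrence. *)
Lemma fib_cassini k :
  (fib k.+1)%:R ^+ 2 - (fib k.+1)%:R * (fib k)%:R - (fib k)%:R ^+ 2
  = (-1) ^+ k :> R.
Proof.
elim: k => [|k IHk]; first by rewrite /=; ring.
by rewrite natr_fibSS [(-1) ^+ k.+1]exprS -IHk; ring.
Qed.

Lemma lucas_cassini k :
  (lucas k.+1)%:R ^+ 2 - (lucas k.+1)%:R * (lucas k)%:R - (lucas k)%:R ^+ 2
  = - 5 * (-1) ^+ k :> R.
Proof.
elim: k => [|k IHk]; first by rewrite /=; ring.
by rewrite natr_lucasSS [(-1) ^+ k.+1]exprS mulrCA -IHk; ring.
Qed.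

Lemma lucas_fib k : (lucas k)%:R = 2 * (fib k.+1)%:R - (fib k)%:R :> R.
Proof.
suff [] : (lucas k)%:R = 2 * (fib k.+1)%:R - (fib k)%:R :> R
  /\ (lucas k.+1)%:R = 2 * (fib k.+2)%:R - (fib k.+1)%:R :> R by [].
elim: k => [|k [IHk IHSk]]; first by rewrite /=; split; ring.
by split=> //; rewrite natr_lucasSS IHSk IHk !natr_fibSS; ring.
Qed.

Lemma lucas_sqr k :
  (lucas k)%:R ^+ 2 = 5 * (fib k)%:R ^+ 2 + 4 * (-1) ^+ k :> R.
Proof. by rewrite lucas_fib -fib_cassini; ring. Qed.

(* The coefficient [fib k.+1 - fib k] stands for F_(k-1), so [k = 0] is allowed. *)
Lemma lucas_add m k :
  (lucas (m + k))%:R = (fib k)%:R * (lucas m.+1)%:R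
    + ((fib k.+1)%:R - (fib k)%:R) * (lucas m)%:R :> R.
Proof.
elim: k m => [|k IHk] m; first by rewrite addn0 /=; ring.
by rewrite addnS -addSn IHk natr_lucasSS natr_fibSS; ring.
Qed.

(** Shifting the index by k acts on (L_(m+1), L_m) as the k-th power of the Fibonacci matrix, of
    trace L_k and determinant (-1)^k; this is its Cayley-Hamilton identity. *)
Lemma lucas_step m k :
  (lucas (m + k + k))%:R
  = (lucas k)%:R * (lucas (m + k))%:R - (-1) ^+ k * (lucas m)%:R :> R.
Proof.
rewrite (lucas_add (m + k)) -addSn !lucas_add natr_lucasSS (lucas_fib k).
by rewrite -fib_cassini; ring.
Qed.

(** As L_k = F_(k-1) + F_(k+1) and (-1)^k = F_(k-1) F_(k+1) - F_k^2, the form is (L_(m+k) - F_(k-1)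
    L_m) (L_(m+k) - F_(k+1) L_m) - F_k^2 L_m^2, with factors F_k L_(m+1) and F_k (L_(m+1) - L_m). *)
Lemma lucas_step_form m k :
  (lucas (m + k))%:R ^+ 2 - (lucas k)%:R * (lucas m)%:R * (lucas (m + k))%:R
    + (-1) ^+ k * (lucas m)%:R ^+ 2
  = - 5 * (-1) ^+ m * (fib k)%:R ^+ 2 :> R.
Proof.
by rewrite -lucas_cassini lucas_add (lucas_fib k) -fib_cassini; ring.
Qed.

Lemma lucas_det m k (x := fun i => (lucas (m + i * k))%:R : R) :
  (x 2 - x 0) * (x 5 - x 1) - (x 4 - x 0) * (x 3 - x 1)
  = - (-1) ^+ m * (if odd k then 5 * (fib k)%:R ^+ 2 * (lucas k)%:R ^+ 3
                   else 25 * (fib k)%:R ^+ 4 * (lucas k)%:R).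
Proof.
have stepx i : x i.+2 = (lucas k)%:R * x i.+1 - (-1) ^+ k * x i.
  by rewrite /x !mulSn ![(k + _)%N]addnC !addnA lucas_step.
have := lucas_step_form m k.
have -> : (lucas m)%:R = x 0 by rewrite /x mul0n addn0.
have -> : (lucas (m + k))%:R = x 1 by rewrite /x mul1n.
move=> formE; set s := (-1) ^+ k in stepx formE; set L : R := (lucas k)%:R.
transitivity (L * (L ^+ 2 - (1 + s) ^+ 2)
              * (x 1 ^+ 2 - L * x 0 * x 1 + s * x 0 ^+ 2)).
  by rewrite !stepx -/L; ring.
(* For k odd, s = -1 kills (1 + s)^2, and L^3 remains. *)
rewrite formE /s -(signr_odd R k); case: ifP => k_odd; first by rewrite expr1; ring.
by rewrite /L lucas_sqr -(signr_odd R k) k_odd expr0; ring.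
Qed.

End FibonacciLucas.

Theorem theorem2p3 (R : realFieldType) (n k : nat) (hk : (1 <= k)%N) :
  triangle_area (lucas_point R n (n + k))
                (lucas_point R (n + 2 * k) (n + 3 * k))
                (lucas_point R (n + 4 * k) (n + 5 * k)) =
  if odd k then 5 * (fib k)%:R ^+ 2 * (lucas k)%:R ^+ 3 / 2
  else 25 / 2 * (fib k)%:R ^+ 4 * (lucas k)%:R.
Proof.
have := @lucas_det R n k; rewrite /= mul0n mul1n addn0.
rewrite /triangle_area /lucas_point /= => ->.
(* The absolute value removes the orientation sign -(-1)^n; the other factor is nonnegative for
   either parity of k. *)
rewrite normrM normrN normrX normrN1 expr1n mul1r.
by case: (odd k); rewrite ger0_norm ?mulr_ge0 ?exprn_ge0 ?ler0n //; ring.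
Qed.
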